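(* Let $q\in\mathbb{C}$ with $0<|q|<1$ and let $h$ be the Haar state on $\mathcal{O}(SL_q(3))$, with generators denoted $a,b,c,d,e,f,g,h,k$. For every integer $m\ge 1$, $$h\big(aek(ceg)^{m-1}\big)=\frac{(-q)^{3m-2}(q^2-1)^3(q^4-1)(1+q^4-q^2-q^{2m+2})}{q(q^{2m}-1)^2(q^{2m+2}-1)^2(q^{2m+4}-1)},$$ $$h\big(afh(ceg)^{m-1}\big)=h\big(bdk(ceg)^{m-1}\big)=\frac{(-q)^{3m-2}(q^2-1)^4(q^4-1)}{(q^{2m}-1)^2(q^{2m+2}-1)^2(q^{2m+4}-1)},$$ $$h\big(bfg(ceg)^{m-1}\big)=h\big(cdh(ceg)^{m-1}\big)=\frac{(-q)^{3m-1}(q^2-1)^3(q^4-1)}{(q^{2m}-1)(q^{2m+2}-1)^2(q^{2m+4}-1)},$$ $$h\big((ceg)^{m}\big)=\frac{(-q)^{3m}(q^2-1)^2(q^4-1)}{(q^{2m+2}-1)^2(q^{2m+4}-1)},$$ and for every $m\ge 2$, $$h\big(bfgcdh(ceg)^{m-2}\big)=\frac{(-q)^{3m-2}(q^2-1)^4(q^4-1)}{(q^{2m}-1)^2(q^{2m+2}-1)^2(q^{2m+4}-1)}.$$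
   Context: $\mathcal{O}(SL_q(3))$ is the unital $\mathbb{C}$-algebra generated by $x_{ij}$, $1\le i,j\le 3$, with relations: $x_{ik}x_{il}=q\,x_{il}x_{ik}$ for $k<l$; $x_{ik}x_{jk}=q\,x_{jk}x_{ik}$ for $i<j$; $x_{il}x_{jk}=x_{jk}x_{il}$ and $x_{ik}x_{jl}=x_{jl}x_{ik}+(q-q^{-1})x_{il}x_{jk}$ for $i<j$, $k<l$; and $\sum_{\sigma\in S_3}(-q)^{l(\sigma)}x_{1,\sigma(1)}x_{2,\sigma(2)}x_{3,\sigma(3)}=1$, where $l(\sigma)$ is the number of inversions of $\sigma$. It is a Hopf algebra with comultiplication $\Delta(x_{ij})=\sum_{k=1}^3 x_{ik}\otimes x_{kj}$. The generators are written $$\begin{pmatrix} x_{11} & x_{12} & x_{13} \\ x_{21} & x_{22} & x_{23} \\ x_{31} & x_{32} & x_{33} \end{pmatrix}=\begin{pmatrix} a & b & c \\ d & e & f \\ g & h & k \end{pmatrix}.$$ The Haar state is the unique linear functional, also denoted $h$ (always written with parentheses $h(\cdot)$, to distinguish it from the generator $h=x_{32}$), satisfying $h(1)=1$ and $(\mathrm{Id}\otimes h)\circ\Delta(x)=h(x)\cdot 1=(h\otimes\mathrm{Id})\circ\Delta(x)$ for all $x$. *)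

(* Defs.v *)
From HB Require Import structures.
From mathcomp Require Import all_boot all_order perm all_algebra.
From mathcomp Require Import boolp reals finmap complex monalg.

Set Implicit Arguments.
Unset Strict Implicit.
Unset Printing Implicit Defensive.

Import GRing.Theory Num.Theory.
Local Open Scope ring_scope.
Local Open Scope quotient_scope.

Inductive lspan (K : pzRingType) (V : lmodType K) (S : V -> Prop) : V -> Prop :=
| lspan_gen v of S v : lspan S v
| lspan_0 : lspan S 0
| lspan_D u v of lspan S u & lspan S v : lspan S (u + v)
| lspan_Z c v of lspan S v : lspan S (c *: v).

Definition lspanb (K : pzRingType) (V : lmodType K) (S : V -> Prop) : {pred V} :=
  fun v => `[< lspan S v >].

Fact lspanb_zmod (K : pzRingType) (V : lmodType K) (S : V -> Prop) :
  zmod_closed (lspanb S).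
Proof.
split=> [|u v /asboolP Su /asboolP Sv]; apply/asboolP; first exact: lspan_0.
by rewrite -scaleN1r; apply: lspan_D => //; apply: lspan_Z.
Qed.
HB.instance Definition _ (K : pzRingType) (V : lmodType K) (S : V -> Prop) :=
  GRing.isZmodClosed.Build V (lspanb S) (lspanb_zmod S).

Definition lquot (K : pzRingType) (V : lmodType K) (S : V -> Prop) : Type :=
  Quotient.quot (lspanb S : zmodClosed V).
HB.instance Definition _ (K : pzRingType) (V : lmodType K) (S : V -> Prop) :=
  Choice.on (lquot S).

(* The operations are locked to keep unification from unfolding them. *)
HB.lock Definition lpi (K : pzRingType) (V : lmodType K) (S : V -> Prop) (v : V) :
  lquot S := \pi_(Quotient.quot (lspanb S : zmodClosed V)) v.
HB.lock Definition lrepr (K : pzRingType) (V : lmodType K) (S : V -> Prop)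
  (x : lquot S) : V := repr (x : Quotient.quot (lspanb S : zmodClosed V)).
HB.lock Definition lquot_add (K : pzRingType) (V : lmodType K) (S : V -> Prop)
  (x y : lquot S) : lquot S := lpi S (lrepr x + lrepr y).
HB.lock Definition lquot_scale (K : pzRingType) (V : lmodType K) (S : V -> Prop)
  (c : K) (x : lquot S) : lquot S := lpi S (c *: lrepr x).

Section LQuot.
Variables (K : pzRingType) (V : lmodType K) (S : V -> Prop).

Lemma lreprK (x : lquot S) : lpi S (lrepr x) = x.
Proof. by rewrite lpi.unlock lrepr.unlock; apply: reprK. Qed.

Lemma lpi_eq u v : (lpi S u = lpi S v) <-> lspan S (u - v).
Proof.
rewrite lpi.unlock; split=> [/eqP|Suv].
  by rewrite -Quotient.idealrBE => /asboolP.
by apply/eqP; rewrite -Quotient.idealrBE; apply/asboolP.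
Qed.

Lemma lspan_lrepr v : lspan S (lrepr (lpi S v) - v).
Proof. by apply/lpi_eq; rewrite lreprK. Qed.

Lemma lquot_addE u v : lquot_add (lpi S u) (lpi S v) = lpi S (u + v).
Proof.
rewrite lquot_add.unlock; apply/lpi_eq; rewrite opprD addrACA.
by apply: lspan_D; apply: lspan_lrepr.
Qed.

Lemma lquot_scaleE c v : lquot_scale c (lpi S v) = lpi S (c *: v).
Proof.
by rewrite lquot_scale.unlock; apply/lpi_eq; rewrite -scalerBr; apply/lspan_Z/lspan_lrepr.
Qed.

Fact lquot_addA : associative (@lquot_add K V S).
Proof.
by move=> x y z; rewrite -[x]lreprK -[y]lreprK -[z]lreprK !lquot_addE addrA.
Qed.
Fact lquot_addC : commutative (@lquot_add K V S).
Proof. by move=> x y; rewrite -[x]lreprK -[y]lreprK !lquot_addE addrC. Qed.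
Fact lquot_add0 : left_id (lpi S 0) (@lquot_add K V S).
Proof. by move=> x; rewrite -[x]lreprK lquot_addE add0r. Qed.
Fact lquot_addN : left_inverse (lpi S 0) (lquot_scale (-1)) (@lquot_add K V S).
Proof.
by move=> x; rewrite -[x]lreprK lquot_scaleE lquot_addE scaleN1r addNr.
Qed.
HB.instance Definition _ := GRing.isZmodule.Build (lquot S)
  lquot_addA lquot_addC lquot_add0 lquot_addN.

Fact lquot_scaleA a b (x : lquot S) :
  lquot_scale a (lquot_scale b x) = lquot_scale (a * b) x.
Proof. by rewrite -[x]lreprK !lquot_scaleE scalerA. Qed.
Fact lquot_scale1 : left_id 1 (@lquot_scale K V S).
Proof. by move=> x; rewrite -[x]lreprK lquot_scaleE scale1r. Qed.
Fact lquot_scaleDr : right_distributive (@lquot_scale K V S) +%R.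
Proof.
move=> c x y; rewrite -[x]lreprK -[y]lreprK.
by rewrite [LHS](congr1 _ (lquot_addE _ _)) !lquot_scaleE scalerDr -lquot_addE.
Qed.
Fact lquot_scaleDl (x : lquot S) : {morph (@lquot_scale K V S)^~ x : a b / a + b}.
Proof.
by move=> a b; rewrite -[x]lreprK /= !lquot_scaleE scalerDl -lquot_addE.
Qed.
HB.instance Definition _ := GRing.Zmodule_isLmodule.Build K (lquot S)
  lquot_scaleA lquot_scale1 lquot_scaleDr lquot_scaleDl.

Lemma lpiP c u v : lpi S (c *: u + v) = c *: lpi S u + lpi S v.
Proof. by rewrite -lquot_addE -lquot_scaleE. Qed.

HB.instance Definition _ := GRing.isLinear.Build K V (lquot S) *:%R (lpi S) lpiP.

Lemma lquot_ind (P : lquot S -> Prop) : (forall v, P (lpi S v)) -> forall x, P x.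
Proof. by move=> IH x; rewrite -[x]lreprK. Qed.

End LQuot.

(* The two-sided ideal generated by [S] is the linear span of the [a r b],
   [r] in [S]. *)
Definition sandwich (K : pzRingType) (A : algType K) (S : A -> Prop) (u : A) :=
  exists a b r, S r /\ u = a * r * b.

Definition aquot (K : pzRingType) (A : algType K) (S : A -> Prop) : Type :=
  lquot (sandwich S).
HB.instance Definition _ (K : pzRingType) (A : algType K) (S : A -> Prop) :=
  GRing.Lmodule.on (aquot S).

HB.lock Definition api (K : pzRingType) (A : algType K) (S : A -> Prop) (u : A) :
  aquot S := lpi (sandwich S) u.
HB.lock Definition aquot_mul (K : pzRingType) (A : algType K) (S : A -> Prop)
  (x y : aquot S) : aquot S := api S (lrepr x * lrepr y).

Section AQuot.
Variables (K : pzRingType) (A : algType K) (S : A -> Prop).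

Let I := lspan (sandwich S).

Lemma ideal_mull a u : I u -> I (a * u).
Proof.
elim=> {u} [v [b [c [r [Sr ->]]]]||u v _ Iu _ Iv|c v _ Iv].
- by apply: lspan_gen; exists (a * b), c, r; rewrite !mulrA.
- by rewrite mulr0; apply: lspan_0.
- by rewrite mulrDr; apply: lspan_D.
- by rewrite -scalerAr; apply: lspan_Z.
Qed.

Lemma ideal_mulr a u : I u -> I (u * a).
Proof.
elim=> {u} [v [b [c [r [Sr ->]]]]||u v _ Iu _ Iv|c v _ Iv].
- by apply: lspan_gen; exists b, (c * a), r; rewrite !mulrA.
- by rewrite mul0r; apply: lspan_0.
- by rewrite mulrDl; apply: lspan_D.
- by rewrite -scalerAl; apply: lspan_Z.
Qed.

Fact api_is_linear : linear (api S).
Proof. by rewrite api.unlock; exact: lpiP. Qed.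
HB.instance Definition _ :=
  GRing.isLinear.Build K A (aquot S) *:%R (api S) api_is_linear.

Lemma api_eq u v : (api S u = api S v) <-> I (u - v).
Proof. by rewrite api.unlock; exact: lpi_eq. Qed.

Lemma aquot_mulE u v : aquot_mul (api S u) (api S v) = api S (u * v).
Proof.
rewrite aquot_mul.unlock; apply/api_eq.
have H w : I (lrepr (api S w) - w) by rewrite api.unlock; exact: lspan_lrepr.
move: (H u) (H v); set u' := lrepr _; set v' := lrepr _ => Hu Hv.
have -> : u' * v' - u * v = (u' - u) * v' + u * (v' - v).
  by rewrite mulrBl mulrBr addrA subrK.
by apply: lspan_D; [apply: ideal_mulr|apply: ideal_mull].
Qed.

Lemma aquot_ind (P : aquot S -> Prop) : (forall u, P (api S u)) -> forall x, P x.
Proof. by rewrite api.unlock; exact: lquot_ind. Qed.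

Fact aquot_mulA : associative (@aquot_mul K A S).
Proof.
by elim/aquot_ind=> x; elim/aquot_ind=> y; elim/aquot_ind=> z; rewrite !aquot_mulE mulrA.
Qed.
Fact aquot_mul1 : left_id (api S 1) (@aquot_mul K A S).
Proof. by elim/aquot_ind=> x; rewrite aquot_mulE mul1r. Qed.
Fact aquot_1mul : right_id (api S 1) (@aquot_mul K A S).
Proof. by elim/aquot_ind=> x; rewrite aquot_mulE mulr1. Qed.
Fact aquot_mulDl : left_distributive (@aquot_mul K A S) +%R.
Proof.
elim/aquot_ind=> x; elim/aquot_ind=> y; elim/aquot_ind=> z.
by rewrite -raddfD !aquot_mulE mulrDl raddfD.
Qed.
Fact aquot_mulDr : right_distributive (@aquot_mul K A S) +%R.
Proof.
elim/aquot_ind=> x; elim/aquot_ind=> y; elim/aquot_ind=> z.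
by rewrite -raddfD !aquot_mulE mulrDr raddfD.
Qed.
HB.instance Definition _ := GRing.Zmodule_isPzRing.Build (aquot S)
  aquot_mulA aquot_mul1 aquot_1mul aquot_mulDl aquot_mulDr.

Fact api_is_monoid : monoid_morphism (api S).
Proof. by split=> // u v; rewrite -aquot_mulE. Qed.
HB.instance Definition _ :=
  GRing.isMonoidMorphism.Build A (aquot S) (api S) api_is_monoid.

Lemma apiM u v : api S (u * v) = api S u * api S v.
Proof. exact: rmorphM. Qed.

Lemma apiZ c u : api S (c *: u) = c *: api S u.
Proof. exact: linearZ. Qed.

Fact aquot_scaleAl c (x y : aquot S) : c *: (x * y) = c *: x * y.
Proof.
elim/aquot_ind: x => x; elim/aquot_ind: y => y.
by rewrite -apiM -!apiZ -apiM scalerAl.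
Qed.
Fact aquot_scaleAr c (x y : aquot S) : c *: (x * y) = x * (c *: y).
Proof.
elim/aquot_ind: x => x; elim/aquot_ind: y => y.
by rewrite -apiM -!apiZ -apiM scalerAr.
Qed.

Lemma api_rel r : S r -> api S r = 0.
Proof.
move=> Sr; rewrite -(raddf0 (api S)); apply/api_eq; rewrite subr0.
by apply: lspan_gen; exists 1, 1, r; rewrite mulr1 mul1r.
Qed.

End AQuot.

Fact malg_scaleAr (K : comNzRingType) (M : monomType) c (x y : {malg K[M]}) :
  c *: (x * y) = x * (c *: y).
Proof.
rewrite [x * y]malgME scaler_sumr.
rewrite [RHS](malgMEw (fsubset_refl (msupp x)) (msuppZ_le c y)).
apply: eq_bigr => k1 _; rewrite scaler_sumr; apply: eq_bigr => k2 _.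
by rewrite mcoeffZ; apply/malgP => k; rewrite mcoeffZ !mcoeffU mulrnAr mulrCA.
Qed.

Definition freealg (K : comNzRingType) (I : choiceType) : Type :=
  {malg K[{fmonom I}]}.
HB.instance Definition _ (K : comNzRingType) (I : choiceType) :=
  Choice.on (freealg K I).

HB.lock Definition fgen (K : comNzRingType) (I : choiceType) (i : I) : freealg K I :=
  mkmalgU (fmu i) 1.
HB.lock Definition freealg_add (K : comNzRingType) (I : choiceType)
  (u v : {malg K[{fmonom I}]}) : freealg K I := u + v.
HB.lock Definition freealg_opp (K : comNzRingType) (I : choiceType)
  (u : {malg K[{fmonom I}]}) : freealg K I := - u.
HB.lock Definition freealg_mul (K : comNzRingType) (I : choiceType)
  (u v : {malg K[{fmonom I}]}) : freealg K I := u * v.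
HB.lock Definition freealg_scale (K : comNzRingType) (I : choiceType)
  (c : K) (u : {malg K[{fmonom I}]}) : freealg K I := c *: u.

Section FreeAlg.
Variables (K : comNzRingType) (I : choiceType).
Local Notation M := {malg K[{fmonom I}]}.
Local Notation F := (freealg K I).
Local Notation add := (@freealg_add K I : F -> F -> F).
Local Notation opp := (@freealg_opp K I : F -> F).
Local Notation mul := (@freealg_mul K I : F -> F -> F).
Local Notation scale := (@freealg_scale K I : K -> F -> F).

Fact freealg_addA : associative add.
Proof. by rewrite freealg_add.unlock; exact: (@addrA M). Qed.
Fact freealg_addC : commutative add.
Proof. by rewrite freealg_add.unlock; exact: (@addrC M). Qed.
Fact freealg_add0 : left_id (0 : M) add.
Proof. by rewrite freealg_add.unlock; exact: (@add0r M). Qed.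
Fact freealg_addN : left_inverse (0 : M) opp add.
Proof. by rewrite freealg_add.unlock freealg_opp.unlock; exact: (@addNr M). Qed.
HB.instance Definition _ := GRing.isZmodule.Build F
  freealg_addA freealg_addC freealg_add0 freealg_addN.

Fact freealg_mulA : associative mul.
Proof. by rewrite freealg_mul.unlock; exact: (@mulrA M). Qed.
Fact freealg_mul1 : left_id (1 : M) mul.
Proof. by rewrite freealg_mul.unlock; exact: (@mul1r M). Qed.
Fact freealg_1mul : right_id (1 : M) mul.
Proof. by rewrite freealg_mul.unlock; exact: (@mulr1 M). Qed.
Fact freealg_mulDl : left_distributive mul add.
Proof. by rewrite freealg_mul.unlock freealg_add.unlock; exact: (@mulrDl M). Qed.
Fact freealg_mulDr : right_distributive mul add.
Proof. by rewrite freealg_mul.unlock freealg_add.unlock; exact: (@mulrDr M). Qed.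
Fact freealg_nontrivial : (1 : M) != 0 :> F.
Proof. exact: (@oner_neq0 M). Qed.
HB.instance Definition _ := GRing.Zmodule_isNzRing.Build F
  freealg_mulA freealg_mul1 freealg_1mul freealg_mulDl freealg_mulDr
  freealg_nontrivial.

Fact freealg_scaleA a b u : scale a (scale b u) = scale (a * b) u.
Proof. by rewrite freealg_scale.unlock; exact: (@scalerA K M). Qed.
Fact freealg_scale1 : left_id 1 scale.
Proof. by rewrite freealg_scale.unlock; exact: (@scale1r K M). Qed.
Fact freealg_scaleDr : right_distributive scale add.
Proof. by rewrite freealg_scale.unlock freealg_add.unlock; exact: (@scalerDr K M). Qed.
Fact freealg_scaleDl u a b : scale (a + b) u = add (scale a u) (scale b u).
Proof. by rewrite freealg_scale.unlock freealg_add.unlock; exact: (@scalerDl K M). Qed.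
HB.instance Definition _ := GRing.Zmodule_isLmodule.Build K F
  freealg_scaleA freealg_scale1 freealg_scaleDr freealg_scaleDl.

Fact freealg_scaleAl c u v : scale c (mul u v) = mul (scale c u) v.
Proof. by rewrite freealg_scale.unlock freealg_mul.unlock; exact: (@scalerAl K M). Qed.
HB.instance Definition _ := GRing.Lmodule_isLalgebra.Build K F freealg_scaleAl.
Fact freealg_scaleAr c u v : scale c (mul u v) = mul u (scale c v).
Proof. by rewrite freealg_scale.unlock freealg_mul.unlock; exact: malg_scaleAr. Qed.
HB.instance Definition _ := GRing.Lalgebra_isAlgebra.Build K F freealg_scaleAr.

End FreeAlg.

HB.lock Definition free_eval (K : comNzRingType) (I : choiceType) (B : algType K)
    (f : I -> B) (u : freealg K I) : B :=
  mmap (in_alg B) (fun m : {fmonom I} => \prod_(i <- m) f i) u.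

Section FreeEval.
Variables (K : comNzRingType) (I : choiceType) (B : algType K) (f : I -> B).

Let h (m : {fmonom I}) : B := \prod_(i <- m) f i.
Fact free_eval_mmorphism : mmorphism h.
Proof. by split=> [m1 m2|]; rewrite /h ?fmM ?big_cat // fm1 big_nil. Qed.
HB.instance Definition _ := isMultiplicative.Build _ _ h free_eval_mmorphism.

Fact free_eval_is_linear : linear (free_eval f).
Proof.
move=> c u v; rewrite free_eval.unlock -[_ + _]/(freealg_add _ _).
rewrite -[c *: u]/(freealg_scale _ _) freealg_add.unlock freealg_scale.unlock.
by rewrite [LHS](mmapD (f := in_alg B)) (mmapZ (f := in_alg B) (h := h)) mulr_algl.
Qed.
HB.instance Definition _ :=
  GRing.isLinear.Build K (freealg K I) B *:%R (free_eval f) free_eval_is_linear.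

Fact free_eval_is_monoid : monoid_morphism (free_eval f).
Proof.
rewrite free_eval.unlock; split.
  exact: (mmap1 (f := in_alg B) (h := h)).
move=> u v; rewrite -[u * v]/(freealg_mul _ _) freealg_mul.unlock.
apply: (commr_mmap_is_multiplicative (f := in_alg B) (h := h) _).1 => g m m'.
by rewrite /GRing.comm /= mulr_algl mulr_algr.
Qed.
HB.instance Definition _ := GRing.isMonoidMorphism.Build (freealg K I) B
  (free_eval f) free_eval_is_monoid.

Lemma free_evalE i : free_eval f (fgen K i) = f i.
Proof.
rewrite free_eval.unlock fgen.unlock (mmapU (f := in_alg B)) /= fmU big_seq1.
by rewrite scale1r mul1r.
Qed.
End FreeEval.

Definition free_pair (K : comNzRingType) (U V : lmodType K) (u : U) (v : V) :
  {malg K[(U * V)%type]} := mkmalgU (u, v) 1.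

Inductive tensor_rel (K : comNzRingType) (U V : lmodType K) :
  {malg K[(U * V)%type]} -> Prop :=
| tensor_rel_l c u u' v : tensor_rel
    (free_pair (c *: u + u') v - (c *: free_pair u v + free_pair u' v))
| tensor_rel_r c u v v' : tensor_rel
    (free_pair u (c *: v + v') - (c *: free_pair u v + free_pair u v')).

Definition tensor (K : comNzRingType) (U V : lmodType K) : Type :=
  lquot (@tensor_rel K U V).
HB.instance Definition _ (K : comNzRingType) (U V : lmodType K) :=
  GRing.Lmodule.on (tensor U V).

HB.lock Definition tens (K : comNzRingType) (U V : lmodType K) (u : U) (v : V) :
  tensor U V := lpi (@tensor_rel K U V) (free_pair u v).

Section Tensor.
Variables (K : comNzRingType) (U V : lmodType K).

Let tpi : {malg K[(U * V)%type]} -> tensor U V := lpi (@tensor_rel K U V).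

Let tensE (u : U) (v : V) : tens u v = tpi (free_pair u v).
Proof. by rewrite tens.unlock. Qed.

Let tpiP c g1 g2 : tpi (c *: g1 + g2) = c *: tpi g1 + tpi g2.
Proof. exact: lpiP. Qed.

Fact tens_linl c (u u' : U) (v : V) : tens (c *: u + u') v = c *: tens u v + tens u' v.
Proof.
by rewrite !tensE -tpiP; apply/(lpi_eq (@tensor_rel K U V))/lspan_gen/tensor_rel_l.
Qed.
Fact tens_linr c (u : U) (v v' : V) : tens u (c *: v + v') = c *: tens u v + tens u v'.
Proof.
by rewrite !tensE -tpiP; apply/(lpi_eq (@tensor_rel K U V))/lspan_gen/tensor_rel_r.
Qed.

Lemma tensor_ind (P : tensor U V -> Prop) : P 0 ->
  (forall c u v t, P t -> P (c *: tens u v + t)) -> forall t, P t.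
Proof.
move=> P0 PD t; rewrite -[t]lreprK -/tpi.
have tpi0 : tpi 0 = 0 by have := tpiP (-1) 0 0; rewrite !scaleN1r !addNr.
rewrite [lrepr t]monalgE.
elim: (X in \sum_(k <- X) _) => [|[u v] s IHs]; first by rewrite big_nil tpi0.
rewrite big_cons; set c := mcoeff _ _.
have -> : mkmalgU (u, v) c = c *: free_pair u v.
  by apply/malgP=> k; rewrite mcoeffZ !mcoeffU mulrnAr mulr1.
by rewrite tpiP -tensE; apply: PD.
Qed.

End Tensor.

Definition bilin (K : pzRingType) (U V W : lmodType K) (f : U -> V -> W) :=
  (forall c u u' v, f (c *: u + u') v = c *: f u v + f u' v) /\
  (forall c u v v', f u (c *: v + v') = c *: f u v + f u v').

Section FreeLift.
Variables (K : comNzRingType) (T : choiceType) (W : lmodType K) (f : T -> W).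

Definition malg_lift (g : {malg K[T]}) : W :=
  \sum_(k <- msupp g) mcoeff k g *: f k.

Lemma malg_liftEw (d : {fset T}) g : (msupp g `<=` d)%fset ->
  malg_lift g = \sum_(k <- d) mcoeff k g *: f k.
Proof.
move=> le; rewrite [LHS](big_fset_incl _ le) => //= x xd /mcoeff_outdom ->.
by rewrite scale0r.
Qed.

Lemma malg_liftU c k : malg_lift (mkmalgU k c) = c *: f k.
Proof. by rewrite (malg_liftEw msuppU_le) big_seq_fset1 mcoeffUU. Qed.

Lemma malg_lift_is_linear : linear malg_lift.
Proof.
move=> c g1 g2; pose d := (msupp g1 `|` msupp g2 `|` msupp (c *: g1 + g2))%fset.
have [h1 h2 h3] : [/\ (msupp g1 `<=` d)%fset, (msupp g2 `<=` d)%fset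
    & (msupp (c *: g1 + g2) `<=` d)%fset].
  split; rewrite /d ?fsubsetUr //; apply: fsubset_trans (fsubsetUl _ _).
    exact: fsubsetUl.
  exact: fsubsetUr.
rewrite !(malg_liftEw (d := d)) // scaler_sumr -big_split /=.
by apply: eq_bigr => k _; rewrite mcoeffD mcoeffZ scalerDl scalerA.
Qed.
End FreeLift.

(* The linear map induced on the tensor product by [f]; it is only meaningful
   when [f] is bilinear, as then the choice of representative is immaterial. *)
HB.lock Definition tensor_lift (K : comNzRingType) (U V W : lmodType K) (f : U -> V -> W) (t : tensor U V) : W :=
  malg_lift (fun p => f p.1 p.2) (lrepr t).

Section TensorTheory.
Variables (K : comNzRingType) (U V : lmodType K).

Lemma tens_bilin : bilin (@tens K U V).
Proof. by split=> *; rewrite (tens_linl, tens_linr). Qed.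

Section Lift.
Variables (W : lmodType K) (f : U -> V -> W).
Hypothesis f_bilin : bilin f.

Let F := malg_lift (fun p : U * V => f p.1 p.2).
Let FP c g1 g2 : F (c *: g1 + g2) = c *: F g1 + F g2.
Proof. exact: malg_lift_is_linear. Qed.
Let F0 : F 0 = 0.
Proof. by have := FP (-1) 0 0; rewrite scaleN1r oppr0 addr0 => ->; rewrite scaleN1r addNr. Qed.
Let FD g1 g2 : F (g1 + g2) = F g1 + F g2.
Proof. by have := FP 1 g1 g2; rewrite !scale1r. Qed.
Let FZ c g : F (c *: g) = c *: F g.
Proof. by have := FP c g 0; rewrite F0 !addr0. Qed.

Let F_span g : lspan (@tensor_rel K U V) g -> F g = 0.
Proof.
elim=> {g} [g [c u u' v|c u v v']||g1 g2 _ F1 _ F2|c g _ Fg].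
- rewrite -scaleN1r addrC FP FP /F !malg_liftU !scale1r /= f_bilin.1.
  by rewrite scaleN1r addNr.
- rewrite -scaleN1r addrC FP FP /F !malg_liftU !scale1r /= f_bilin.2.
  by rewrite scaleN1r addNr.
- exact: F0.
- by rewrite FD F1 F2 addr0.
- by rewrite FZ Fg scaler0.
Qed.

Let lift_pi g : tensor_lift f (lpi (@tensor_rel K U V) g) = F g.
Proof.
have /F_span : lspan (@tensor_rel K U V) (lrepr (lpi (@tensor_rel K U V) g) - g).
  exact: lspan_lrepr.
rewrite tensor_lift.unlock.
by rewrite -scaleN1r addrC FP scaleN1r addrC => /eqP; rewrite subr_eq0 => /eqP.
Qed.

Lemma tensor_liftE u v : tensor_lift f (tens u v) = f u v.
Proof. by rewrite tens.unlock lift_pi /F malg_liftU scale1r. Qed.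

Lemma tensor_lift_is_linear : linear (tensor_lift f).
Proof.
move=> c; elim/lquot_ind=> g1; elim/lquot_ind=> g2.
by rewrite -lpiP !lift_pi.
Qed.
End Lift.
End TensorTheory.

Fact linACA (K : comNzRingType) (V : lmodType K) c d (x y z t : V) :
  d *: (c *: x + y) + (c *: z + t) = c *: (d *: x + z) + (d *: y + t).
Proof. by rewrite !scalerDr !scalerA [d * c]mulrC addrACA. Qed.

(* [tensor_mul] is the product with (a ⊗ b)(a' ⊗ b') = aa' ⊗ bb';
   [tensor_mull a b] is left multiplication by a ⊗ b. *)
HB.lock Definition tensor_mull (K : comNzRingType) (A B : algType K)
    (a : A) (b : B) : tensor A B -> tensor A B :=
  tensor_lift (fun a' b' => tens (a * a') (b * b')).

HB.lock Definition tensor_mul (K : comNzRingType) (A B : algType K)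
    (s t : tensor A B) : tensor A B :=
  tensor_lift (fun a b => tensor_mull a b t) s.

Section TensorAlg.
Variables (K : comNzRingType) (A B : algType K).
Local Notation T := (tensor A B).

Definition tensor_one : T := tens 1 1.

Let bil2 (a : A) (b : B) : bilin (fun a' b' => tens (a * a') (b * b') : T).
Proof.
by split=> c x y z; rewrite mulrDr -scalerAr (tens_linl, tens_linr).
Qed.

Let lin2 (a : A) (b : B) c t t' :
  tensor_mull a b (c *: t + t') = c *: tensor_mull a b t + tensor_mull a b t'.
Proof. by rewrite tensor_mull.unlock; exact: tensor_lift_is_linear. Qed.

Let lin20 (a : A) (b : B) : tensor_mull a b 0 = 0.
Proof.
have := lin2 a b (-1) 0 0; rewrite scaleN1r oppr0 addr0 => ->.
by rewrite scaleN1r addNr.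
Qed.

Let tensor_mullE (a a' : A) (b b' : B) : tensor_mull a b (tens a' b') = tens (a * a') (b * b').
Proof. by rewrite tensor_mull.unlock tensor_liftE. Qed.

Let bil1 (t : T) : bilin (fun (a : A) (b : B) => tensor_mull a b t).
Proof.
split=> c x y z.
- elim/tensor_ind: t => [|d u v t IHt]; first by rewrite !lin20 scaler0 addr0.
  rewrite !lin2 IHt !tensor_mullE mulrDl -scalerAl tens_linl.
  exact: linACA.
- elim/tensor_ind: t => [|d u v t IHt]; first by rewrite !lin20 scaler0 addr0.
  rewrite !lin2 IHt !tensor_mullE mulrDl -scalerAl tens_linr.
  exact: linACA.
Qed.

Lemma tensor_mul_linl c (s s' t : T) :
  tensor_mul (c *: s + s') t = c *: tensor_mul s t + tensor_mul s' t.
Proof. by rewrite tensor_mul.unlock; exact: (tensor_lift_is_linear (bil1 t)). Qed.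

Lemma tensor_mulE (a a' : A) (b b' : B) :
  tensor_mul (tens a b) (tens a' b') = tens (a * a') (b * b').
Proof. by rewrite tensor_mul.unlock (tensor_liftE (bil1 _)) tensor_mullE. Qed.

Let mul0t (t : T) : tensor_mul 0 t = 0.
Proof.
have := tensor_mul_linl (-1) 0 0 t; rewrite scaleN1r oppr0 addr0 => ->.
by rewrite scaleN1r addNr.
Qed.

Lemma tensor_mul_linr c (s t t' : T) :
  tensor_mul s (c *: t + t') = c *: tensor_mul s t + tensor_mul s t'.
Proof.
elim/tensor_ind: s => [|d u v s IHs]; first by rewrite !mul0t scaler0 addr0.
have mulE t1 : tensor_mul (tens u v) t1 = tensor_mull u v t1.
  by rewrite tensor_mul.unlock; exact: (tensor_liftE (bil1 t1)).
rewrite !tensor_mul_linl IHs !mulE lin2.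
exact: linACA.
Qed.

Let mult0 (s : T) : tensor_mul s 0 = 0.
Proof.
have := tensor_mul_linr (-1) s 0 0; rewrite scaleN1r oppr0 addr0 => ->.
by rewrite scaleN1r addNr.
Qed.

Fact tensor_mulA : associative (@tensor_mul K A B).
Proof.
move=> r s t.
elim/tensor_ind: r => [|c u v r IHr]; first by rewrite !mul0t.
rewrite !tensor_mul_linl IHr; congr (_ *: _ + _) => {r IHr}.
elim/tensor_ind: s => [|d u' v' s IHs]; first by rewrite !(mul0t, mult0).
rewrite !(tensor_mul_linl, tensor_mul_linr) IHs; congr (_ *: _ + _) => {s IHs}.
elim/tensor_ind: t => [|e x y t IHt]; first by rewrite !mult0.
by rewrite !tensor_mul_linr IHt !tensor_mulE !mulrA.
Qed.
Fact tensor_mul1 : left_id tensor_one (@tensor_mul K A B).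
Proof.
elim/tensor_ind=> [|c u v t IHt]; first by rewrite mult0.
by rewrite tensor_mul_linr IHt tensor_mulE !mul1r.
Qed.
Fact tensor_1mul : right_id tensor_one (@tensor_mul K A B).
Proof.
elim/tensor_ind=> [|c u v t IHt]; first by rewrite mul0t.
by rewrite tensor_mul_linl IHt tensor_mulE !mulr1.
Qed.
Fact tensor_mulDl : left_distributive (@tensor_mul K A B) +%R.
Proof. by move=> r s t; have := tensor_mul_linl 1 r s t; rewrite !scale1r. Qed.
Fact tensor_mulDr : right_distributive (@tensor_mul K A B) +%R.
Proof. by move=> r s t; have := tensor_mul_linr 1 r s t; rewrite !scale1r. Qed.

HB.instance Definition _ := GRing.Zmodule_isPzRing.Build T
  tensor_mulA tensor_mul1 tensor_1mul tensor_mulDl tensor_mulDr.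

Lemma tensM (a a' : A) (b b' : B) : tens a b * tens a' b' = tens (a * a') (b * b').
Proof. exact: tensor_mulE. Qed.

Lemma tens1 : tens 1 1 = 1 :> T.
Proof. by []. Qed.

End TensorAlg.

Definition inversions n (s : 'S_n) : nat :=
  #|[set p : 'I_n * 'I_n | (p.1 < p.2)%N && (s p.2 < s p.1)%N]|.

Section SLq3.
Variables (K : fieldType) (q : K).

Local Notation free := (freealg K ('I_3 * 'I_3)%type).
Local Notation y i j := (fgen K (i : 'I_3, j : 'I_3)).

(* Relators are differences of the two sides of the defining relations; rows and
   columns are numbered from 0. *)
Inductive SLq3_rel : free -> Prop :=
| SLq3_row (i k l : 'I_3) of (k < l)%N :
    SLq3_rel (y i k * y i l - q *: (y i l * y i k))
| SLq3_col (i j k : 'I_3) of (i < j)%N :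
    SLq3_rel (y i k * y j k - q *: (y j k * y i k))
| SLq3_anti (i j k l : 'I_3) of (i < j)%N & (k < l)%N :
    SLq3_rel (y i l * y j k - y j k * y i l)
| SLq3_diag (i j k l : 'I_3) of (i < j)%N & (k < l)%N :
    SLq3_rel (y i k * y j l - (y j l * y i k + (q - q^-1) *: (y i l * y j k)))
| SLq3_det :
    SLq3_rel (\sum_(s : 'S_3) (- q) ^+ inversions s *:
                (y 0 (s 0) * y 1 (s 1) * y 2 (s 2)) - 1).

Definition SLq3 : Type := aquot SLq3_rel.
HB.instance Definition _ := GRing.Lmodule.on SLq3.
HB.instance Definition _ := GRing.PzRing.on SLq3.

(* Evaluation at the identity matrix, used only to see that 1 <> 0. *)
Let eps : free -> K^o := free_eval (fun p => (p.1 == p.2)%:R : K^o).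
Let epsM u v : eps (u * v) = eps u * eps v.
Proof. exact: rmorphM. Qed.
Let epsD u v : eps (u + v) = eps u + eps v.
Proof. exact: raddfD. Qed.
Let epsB u v : eps (u - v) = eps u - eps v.
Proof. exact: raddfB. Qed.
Let epsZ c u : eps (c *: u) = c * eps u.
Proof. exact: linearZ. Qed.
Let eps1 : eps 1 = 1.
Proof. exact: rmorph1. Qed.
Let eps0 : eps 0 = 0.
Proof. exact: raddf0. Qed.
Let eps_y i j : eps (y i j) = (i == j)%:R.
Proof. exact: free_evalE. Qed.
Let epsMy i j k l : eps (y i j * y k l) = (i == j)%:R * (k == l)%:R.
Proof. by rewrite epsM 2!eps_y. Qed.

Let eps_rel r : SLq3_rel r -> eps r = 0.
Proof.
case=> {r} [i k l kl|i j k ij|i j k l ij kl|i j k l ij kl|].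
- rewrite epsB epsZ 2!epsMy; move: kl; case: (i =P k) => [->|]; last by rewrite !(mul0r, mulr0) subrr.
  by rewrite ltn_neqAle => /andP[/negbTE kl _]; rewrite -[k == l]/(k == l :> nat) kl !(mul0r, mulr0) subrr.
- rewrite epsB epsZ 2!epsMy; move: ij; case: (i =P k) => [->|]; last by rewrite !(mul0r, mulr0) subrr.
  by rewrite ltn_neqAle eq_sym => /andP[/negbTE kl _]; rewrite -[j == k]/(j == k :> nat) kl !(mul0r, mulr0) subrr.
- by rewrite epsB 2!epsM mulrC subrr.
- rewrite epsB epsD epsZ 3!epsMy [(j == l)%:R * _]mulrC opprD addNKr.
  suff -> : (i == l)%:R * (j == k)%:R = 0 :> K by rewrite mulr0 oppr0.
  case: eqP => [il|]; last by rewrite mul0r.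
  case: eqP => [jk|]; last by rewrite mulr0.
  by move: ij kl; rewrite il jk => lk /(ltn_trans lk); rewrite ltnn.
- have epsS (s : seq 'S_3) (F : 'S_3 -> free) :
      eps (\sum_(i <- s) F i) = \sum_(i <- s) eps (F i).
    by elim: s => [|a s IH]; rewrite ?big_nil ?eps0 // !big_cons epsD IH.
  rewrite epsB epsS eps1 (bigD1 (perm_one 'I_3)) //= big1 => [|s s1].
    rewrite epsZ epsM epsMy eps_y !perm1 !eqxx !mulr1 addr0.
    rewrite [inversions _](_ : _ = 0%N) ?subrr //.
    apply/eqP; rewrite cards_eq0 -subset0; apply/subsetP=> p.
    by rewrite !inE !perm1 => /andP[/ltn_trans/[apply]]; rewrite ltnn.
  rewrite epsZ epsM epsMy eps_y; apply/eqP; rewrite mulf_eq0; apply/orP; right.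
  apply: contraNT s1 => nz; apply/eqP/permP=> i; rewrite perm1.
  have natb (b : bool) : (b%:R == 0 :> K) = ~~ b.
    by case: b; rewrite ?eqxx ?oner_eq0.
  move: nz; rewrite !mulf_eq0 !natb -!negb_and negbK.
  case/andP=> /andP[/eqP s0 /eqP s1] /eqP s2.
  suff [->|[->|->]] : i = 0 \/ i = 1 \/ i = 2 by rewrite -?s0 -?s1 -?s2.
  by case: i => [[|[|[|]]] // ?]; [left|right; left|right; right]; apply: val_inj.
Qed.

Let ideal_proper : ~ lspan (sandwich SLq3_rel) 1.
Proof.
move=> H; suff: eps 1 = 0 by rewrite eps1 => /eqP; rewrite oner_eq0.
elim: H => [v [a [b [r [/eps_rel er ->]]]]||u v _ eu _ ev|c v _ ev].
- by rewrite 2!epsM er mulr0 mul0r.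
- exact: eps0.
- by rewrite epsD eu ev addr0.
- by rewrite epsZ ev mulr0.
Qed.

Fact SLq3_nontrivial : 1 != 0 :> SLq3.
Proof.
apply/eqP; rewrite -(raddf0 (api SLq3_rel)) => /api_eq; rewrite subr0.
exact: ideal_proper.
Qed.
HB.instance Definition _ := GRing.PzSemiRing_isNonZero.Build SLq3 SLq3_nontrivial.
HB.instance Definition _ := GRing.Lmodule_isLalgebra.Build K SLq3 (@aquot_scaleAl _ _ SLq3_rel).
HB.instance Definition _ := GRing.Lalgebra_isAlgebra.Build K SLq3 (@aquot_scaleAr _ _ SLq3_rel).

Definition xgen (i j : 'I_3) : SLq3 := api SLq3_rel (y i j).
End SLq3.

Definition is_comultiplication (K : fieldType) (q : K)
    (Delta : {rmorphism SLq3 q -> tensor (SLq3 q) (SLq3 q)}) : Prop :=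
  scalable Delta /\
  forall i j, Delta (xgen q i j) = \sum_(k < 3) tens (xgen q i k) (xgen q k j).

Section Haar.
Variables (K : fieldType) (A : algType K).

(* Id ⊗ h and h ⊗ Id, with A ⊗ K and K ⊗ A identified with A. *)
Definition id_tensor (h : {scalar A}) : tensor A A -> A :=
  tensor_lift (fun a b => h b *: a).
Definition tensor_id (h : {scalar A}) : tensor A A -> A :=
  tensor_lift (fun a b => h a *: b).

Lemma id_tensor_bilin (h : {scalar A}) : bilin (fun a b : A => h b *: a).
Proof.
split=> c x y z; first by rewrite scalerDr !scalerA [c * _]mulrC.
by rewrite linearP scalerDl scalerA.
Qed.
Lemma tensor_id_bilin (h : {scalar A}) : bilin (fun a b : A => h a *: b).
Proof.
split=> c x y z; first by rewrite linearP scalerDl scalerA.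
by rewrite scalerDr !scalerA [c * _]mulrC.
Qed.

Definition is_haar_state (Delta : A -> tensor A A) (h : {scalar A}) : Prop :=
  h 1 = 1 /\
  forall x, id_tensor h (Delta x) = (h x)%:A /\ (h x)%:A = tensor_id h (Delta x).
End Haar.

(* Main.v *)
From HB Require Import structures.
Require Import Defs.
From mathcomp Require Import all_boot all_order all_algebra.
From mathcomp Require Import perm reals complex zify ring.

Set Implicit Arguments.
Unset Strict Implicit.
Unset Printing Implicit Defensive.

Import GRing.Theory Num.Theory.
Local Open Scope ring_scope.

(** The Haar state is invariant under the quantized Lie algebra, and the
    elements of the theorem are few enough for this to determine its values.

    A representation of the algebra by upper triangular 2 x 2 matrices, applied
    to the left leg of the comultiplication, turns every element into a matrix
    whose upper right entry is a twisted derivation: it moves row r of the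
    generic matrix to row r + 1 and kills the other generators.  The invariance
    (Id (x) h) Delta = h(.) 1 says that the Haar state annihilates whatever such
    a derivation produces ([haar_row_step]).  For the two derivations (row 1 to
    row 2, row 2 to row 3) this gives linear relations between moments as soon
    as an element of the right weight is fed to them.

    The elements c, e, g commute; let M n = (c e g)^n = c^n e^n g^n.  Feeding
    the monomials
      b c^(n+1) e^n g^(n+1),  d e^(n+1) c^(n+1) g^n,  a h c^(n+1) e^n g^n,
      b d h c^(n+2) e^n g^(n+1),  b d f c^n e^n g^n,  a e^(n+1) f c^n g^n
    to the derivations gives [moment_bfg], [moment_cdh], [moment_afh],
    [moment_bfgcdh], [moment_bdk] and [moment_aek]: each of the moments of
    bfg M n, cdh M n, afh M n, bdk M n, aek M n is an explicit multiple of the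
    moment of M (n+1), and that of bfgcdh M n is one of the moment of M (n+2).
    Expanding the quantum determinant in 1 * M n = M n ([moment_det]) then
    closes the system: the moments of M n satisfy a first order recurrence in n
    ([tau_ceg_rec]), whose solution is [tau_ceg]. *)

(** * The quantum determinant and the universal property *)

Lemma ord3P (P : 'I_3 -> Prop) : P 0 -> P 1 -> P 2 -> forall i, P i.
Proof.
move=> P0 P1 P2 [[|[|[|//]]] lt3].
- by rewrite (_ : Ordinal lt3 = 0) //; apply: val_inj.
- by rewrite (_ : Ordinal lt3 = 1) //; apply: val_inj.
- by rewrite (_ : Ordinal lt3 = 2) //; apply: val_inj.
Qed.

Lemma inversions3 (s : 'S_3) :
  inversions s = ((s 1%R < s 0%R) + (s 2%R < s 0%R) + (s 2%R < s 1%R))%N.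
Proof.
rewrite /inversions -sum1dep_card big_mkcond /=.
rewrite -(pair_bigA _ (fun i j : 'I_3 =>
  if (i < j)%N && (s j < s i)%N then 1%N else 0%N)) /=.
rewrite !big_ord_recl !big_ord0 /=.
have -> : ord0 = 0 :> 'I_3 by apply: val_inj.
have -> : lift 0 0 = 1 :> 'I_3 by apply: val_inj.
have -> : lift 0 (lift 0 0) = 2 :> 'I_3 by apply: val_inj.
by do 3 case: (_ < _)%N.
Qed.

Lemma sum_perm3 (V : nmodType) (F : nat -> 'I_3 -> 'I_3 -> 'I_3 -> V) :
  \sum_(s : 'S_3) F (inversions s) (s 0) (s 1) (s 2) =
  F 0 0 1 2 + F 1 1 0 2 + F 1 0 2 1 + F 2 1 2 0 + F 2 2 0 1 + F 3 2 1 0.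
Proof.
pose t01 : 'S_3 := tperm 0 1; pose t12 : 'S_3 := tperm 1 2.
pose l : seq 'S_3 := [:: 1; t01; t12; t12 * t01; t01 * t12; tperm 0 2]%g.
have uniq_l : uniq l.
  apply: (@map_uniq _ _ (fun s : 'S_3 => (s 0, s 1))).
  by rewrite [map _ _]/= /t01 /t12 !permM !perm1 !permE.
have mem_l : l =i index_enum 'S_3.
  apply: (uniq_min_size uniq_l _ _).2 => [s _|]; first exact: mem_index_enum.
  by rewrite -[index_enum _]enumT -cardT card_Sn.
rewrite -(perm_big _ (uniq_perm uniq_l (index_enum_uniq _) mem_l)).
rewrite !big_cons big_nil /= addr0 !addrA !inversions3.
by rewrite /t01 /t12 !permM !perm1 !permE /=.
Qed.

(** The coaction and the 2 x 2 representations are both obtained from tuples of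
    elements obeying the defining relations, whence a predicate on matrices
    over an arbitrary algebra.  The determinant is written out because this is
    the form in which it is computed with. *)
Record qmatrix (K : fieldType) (q : K) (B : algType K) (x : 'I_3 -> 'I_3 -> B) :
  Prop := QMatrix {
  qm_row : forall i k l : 'I_3, (k < l)%N ->
    x i k * x i l = q *: (x i l * x i k);
  qm_col : forall i j k : 'I_3, (i < j)%N ->
    x i k * x j k = q *: (x j k * x i k);
  qm_anti : forall i j k l : 'I_3, (i < j)%N -> (k < l)%N ->
    x i l * x j k = x j k * x i l;
  qm_diag : forall i j k l : 'I_3, (i < j)%N -> (k < l)%N ->
    x i k * x j l = x j l * x i k + (q - q^-1) *: (x i l * x j k);
  qm_det :
    x 0 0 * x 1 1 * x 2 2 - q *: (x 0 1 * x 1 0 * x 2 2)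
    - q *: (x 0 0 * x 1 2 * x 2 1) + q ^+ 2 *: (x 0 1 * x 1 2 * x 2 0)
    + q ^+ 2 *: (x 0 2 * x 1 0 * x 2 1) - q ^+ 3 *: (x 0 2 * x 1 1 * x 2 0) = 1
}.

Lemma qdet_expand (K : fieldType) (q : K) (B : algType K) (x : 'I_3 -> 'I_3 -> B) :
  \sum_(s : 'S_3) (- q) ^+ inversions s *: (x 0 (s 0) * x 1 (s 1) * x 2 (s 2)) =
    x 0 0 * x 1 1 * x 2 2 - q *: (x 0 1 * x 1 0 * x 2 2)
    - q *: (x 0 0 * x 1 2 * x 2 1) + q ^+ 2 *: (x 0 1 * x 1 2 * x 2 0)
    + q ^+ 2 *: (x 0 2 * x 1 0 * x 2 1) - q ^+ 3 *: (x 0 2 * x 1 1 * x 2 0).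
Proof.
rewrite (sum_perm3 (fun n i j k => (- q) ^+ n *: (x 0 i * x 1 j * x 2 k))).
by rewrite expr0 scale1r expr1 sqrrN exprNn -signr_odd expr1 mulN1r !scaleNr.
Qed.

Section Universal.
Variables (K : fieldType) (q : K).

Lemma xgen_qmatrix : qmatrix q (xgen q).
Proof.
have rel (u v : freealg K ('I_3 * 'I_3)%type) :
    SLq3_rel q (u - v) -> api (SLq3_rel q) u = api (SLq3_rel q) v :> SLq3 q.
  by move=> /api_rel; rewrite raddfB => /eqP; rewrite subr_eq0 => /eqP.
split=> *; rewrite /xgen.
- by rewrite -!apiM -apiZ; apply: rel; apply: SLq3_row.
- by rewrite -!apiM -apiZ; apply: rel; apply: SLq3_col.
- by rewrite -!apiM; apply: rel; apply: SLq3_anti.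
- by rewrite -!apiM -apiZ -raddfD; apply: rel; apply: SLq3_diag.
- have := rel _ _ (SLq3_det q).
  rewrite (qdet_expand q (fun i j => fgen K (i, j))).
  by rewrite !(raddfB, raddfD) /= !apiZ !apiM => ->.
Qed.

Lemma SLq3_lift (B : algType K) (f : 'I_3 -> 'I_3 -> B) : qmatrix q f ->
  exists phi : {lrmorphism SLq3 q -> B}, forall i j, phi (xgen q i j) = f i j.
Proof.
move=> qf; pose ev : {lrmorphism freealg K ('I_3 * 'I_3)%type -> B} :=
  free_eval (fun p => f p.1 p.2).
have evM u v : ev (u * v) = ev u * ev v by exact: rmorphM.
have evD u v : ev (u + v) = ev u + ev v by exact: raddfD.
have evB u v : ev (u - v) = ev u - ev v by exact: raddfB.
have evZ c u : ev (c *: u) = c *: ev u by exact: linearZ.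
have evE i j : ev (fgen K (i, j)) = f i j by exact: free_evalE.
have ev_rel r : SLq3_rel q r -> ev r = 0.
  case=> {r} [i k l kl|i j k ij|i j k l ij kl|i j k l ij kl|].
  - by rewrite evB evZ !evM !evE (qm_row qf) // subrr.
  - by rewrite evB evZ !evM !evE (qm_col qf) // subrr.
  - by rewrite evB !evM !evE (qm_anti qf) // subrr.
  - by rewrite evB evD evZ !evM !evE (qm_diag qf) // subrr.
  - rewrite (qdet_expand q (fun i j => fgen K (i, j))).
    rewrite !(evB, evD) !evZ !evM !evE.
    by rewrite (qm_det qf) rmorph1 subrr.
have ev_ideal u : lspan (sandwich (SLq3_rel q)) u -> ev u = 0.
  elim=> {u} [u [a [b [r [/ev_rel er ->]]]]||u v _ eu _ ev0|c u _ eu].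
  - by rewrite !evM er mulr0 mul0r.
  - exact: raddf0.
  - by rewrite evD eu ev0 addr0.
  - by rewrite evZ eu scaler0.
have evP u : ev (lrepr (api (SLq3_rel q) u)) = ev u.
  apply/eqP; rewrite -subr_eq0 -evB; apply/eqP/ev_ideal.
  by rewrite api.unlock; apply: lspan_lrepr.
(* [ev] kills the ideal, so the value at any representative will do. *)
pose phi (x : SLq3 q) := ev (lrepr x).
have phi_lin : linear phi.
  move=> c; elim/aquot_ind=> u; elim/aquot_ind=> v.
  by rewrite -apiZ -raddfD /phi !evP evD evZ.
have phi_mul : monoid_morphism phi.
  split=> [|]; first by rewrite /phi -[1 : SLq3 q]/(api _ 1) evP rmorph1.
  elim/aquot_ind=> u; elim/aquot_ind=> v.
  by rewrite -apiM /phi !evP evM.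
exists (HB.pack_for {lrmorphism SLq3 q -> B} phi
  (GRing.isLinear.Build K _ B *:%R phi phi_lin)
  (GRing.isMonoidMorphism.Build _ B phi phi_mul)) => i j.
by rewrite /= /phi /xgen evP evE.
Qed.
End Universal.

(** * Twisted derivations moving one row to the next *)

Section Invariance.
Variables (K : fieldType) (q : K).

Definition row_weight (r s i : 'I_3) : K :=
  if i == r then q^-1 else if i == s then q else 1.

(** [row_step x r s u w u'] is the graph, on monomials, of the twisted derivation
    E with E (u v) = u E v + E u K v: here u' = E u and K u = w u.  As a relation
    it can be used in any algebra containing a quantum matrix, and the three
    data of a product are read off from those of its factors. *)
Inductive row_step (B : algType K) (x : 'I_3 -> 'I_3 -> B) (r s : 'I_3) :
  B -> K -> B -> Prop :=
| row_step_gen i j :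
    row_step x r s (x i j) (row_weight r s i) (if i == r then x s j else 0)
| row_step_one : row_step x r s 1 1 0
| row_step_mul u a u' v b v' : row_step x r s u a u' -> row_step x r s v b v' ->
    row_step x r s (u * v) (a * b) (u * v' + b *: (u' * v)).

Definition utri2 (a b c : K) : 'M[K]_2 :=
  \matrix_(i, j) if i == j then if i == 0 then a else c
                 else if i == 0 then b else 0.

Lemma utri2M a b c a' b' c' :
  utri2 a b c * utri2 a' b' c' = utri2 (a * a') (a * b' + b * c') (c * c').
Proof.
apply/matrixP => i j; rewrite !mxE !big_ord_recl big_ord0 !mxE /=.
by case: i => [[|[|//]] ?]; case: j => [[|[|//]] ?] /=; ring.
Qed.

Lemma utri2Z d a b c : d *: utri2 a b c = utri2 (d * a) (d * b) (d * c).
Proof.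
apply/matrixP => i j; rewrite !mxE.
by case: i => [[|[|//]] ?]; case: j => [[|[|//]] ?] /=; rewrite ?mulr0.
Qed.

Lemma utri2D a b c a' b' c' :
  utri2 a b c + utri2 a' b' c' = utri2 (a + a') (b + b') (c + c').
Proof.
apply/matrixP => i j; rewrite !mxE.
by case: i => [[|[|//]] ?]; case: j => [[|[|//]] ?] /=; rewrite ?addr0.
Qed.

Lemma utri2_1 : utri2 1 0 1 = 1.
Proof.
apply/matrixP => i j; rewrite !mxE.
by case: i => [[|[|//]] ?]; case: j => [[|[|//]] ?] /=.
Qed.

(** The two diagonal entries are characters of the algebra.  The first is the
    counit, which leaves elements unchanged, so that the off-diagonal entry obeys
    the twisted Leibniz rule of [row_step]; the second rescales row i by
    [row_weight r s i]. *)
Definition row_rep (r s i j : 'I_3) : 'M[K]_2 :=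
  utri2 (i == j)%:R ((i == r) && (j == s))%:R ((i == j)%:R * row_weight r s i).

Lemma row_rep_qmatrix (r s : 'I_3) : q != 0 ->
  (r, s) = (0, 1) \/ (r, s) = (1, 2) -> qmatrix q (row_rep r s).
Proof.
move=> q0 rs.
have utri_eq a b c a' b' c' : a = a' -> b = b' -> c = c' ->
   utri2 a b c = utri2 a' b' c' by move=> -> -> ->.
have utri2E := (utri2M, utri2Z, utri2D).
split; case: rs => -[-> ->]; rewrite /row_rep /row_weight.
1-4: elim/ord3P; elim/ord3P; elim/ord3P => // _; rewrite !utri2E /=;
  by apply: utri_eq; field.
1-4: elim/ord3P; elim/ord3P => //; elim/ord3P; elim/ord3P => // _ _;
  rewrite !utri2E /=; by apply: utri_eq; field.
all: rewrite -!scaleNr !utri2E /= -utri2_1; by apply: utri_eq; field.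
Qed.
End Invariance.

(** * Invariance of the Haar state under the twisted derivations *)

Section Slice.
Variables (K : fieldType) (A : algType K) (n : nat).
Variable phi : {lrmorphism A -> 'M[K]_n.+1}.

(** The map phi_ij (x) Id, with K (x) A identified with A. *)
Definition slice (i j : 'I_n.+1) : tensor A A -> A :=
  tensor_lift (fun a b => phi a i j *: b).

Lemma slice_bilin i j : bilin (fun a b : A => phi a i j *: b).
Proof.
split=> c x y z; first by rewrite linearP !mxE scalerDl scalerA.
by rewrite scalerDr !scalerA [c * _]mulrC.
Qed.

Lemma sliceP i j c t t' :
  slice i j (c *: t + t') = c *: slice i j t + slice i j t'.
Proof. exact: (tensor_lift_is_linear (slice_bilin i j)). Qed.

Lemma slice_tens i j a b : slice i j (tens a b) = phi a i j *: b.
Proof. exact: (tensor_liftE (slice_bilin i j)). Qed.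

HB.instance Definition _ i j :=
  GRing.isLinear.Build K (tensor A A) A *:%R (slice i j) (sliceP i j).

Lemma sliceM i j (s t : tensor A A) :
  slice i j (s * t) = \sum_k slice i k s * slice k j t.
Proof.
elim/tensor_ind: s => [|c a b s IHs].
  by rewrite mul0r raddf0 big1 // => k _; rewrite raddf0 mul0r.
have -> : (c *: tens a b + s) * t = c *: (tens a b * t) + s * t.
  exact: tensor_mul_linl.
rewrite sliceP IHs.
rewrite [RHS](eq_bigr (fun k => c *: (slice i k (tens a b) * slice k j t)
  + slice i k s * slice k j t)) => [|k _]; last first.
  by rewrite sliceP mulrDl scalerAl.
rewrite big_split /= -scaler_sumr; congr (_ *: _ + _) => {s IHs}.
elim/tensor_ind: t => [|d a' b' t IHt].
  by rewrite mulr0 raddf0 big1 // => k _; rewrite raddf0 mulr0.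
have -> : tens a b * (d *: tens a' b' + t) =
    d *: (tens a b * tens a' b') + tens a b * t by exact: tensor_mul_linr.
rewrite sliceP IHt.
rewrite [RHS](eq_bigr (fun k =>
    d *: (slice i k (tens a b) * slice k j (tens a' b'))
    + slice i k (tens a b) * slice k j t)) => [|k _]; last first.
  by rewrite sliceP mulrDr scalerAr.
rewrite big_split /= -scaler_sumr; congr (_ *: _ + _).
rewrite tensM slice_tens rmorphM mxE scaler_suml.
by apply: eq_bigr => k _; rewrite !slice_tens -scalerAl -scalerAr scalerA.
Qed.

(** Both sides are phi_ij (x) h, with the two legs contracted in either order. *)
Lemma haar_slice (haar : {scalar A}) i j (t : tensor A A) :
  haar (slice i j t) = phi (id_tensor haar t) i j.
Proof.
have lin := tensor_lift_is_linear (id_tensor_bilin haar).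
have id0 : id_tensor haar 0 = 0.
  by have := lin (-1) 0 0; rewrite !scaleN1r !addNr.
elim/tensor_ind: t => [|c a b t IHt]; first by rewrite id0 !raddf0 mxE.
rewrite sliceP linearP IHt /id_tensor lin linearP !mxE; congr (_ * _ + _).
by rewrite (tensor_liftE (id_tensor_bilin haar)) slice_tens !linearZ mxE mulrC.
Qed.

(** By invariance the matrix of the values of the Haar state on the slices of
    Delta x is phi (h(x) 1), a scalar matrix. *)
Lemma haar_slice_offdiag (Delta : A -> tensor A A) (haar : {scalar A}) i j x :
  is_haar_state Delta haar -> i != j -> haar (slice i j (Delta x)) = 0.
Proof.
move=> [_ inv] /negbTE nij; rewrite haar_slice (inv x).1.
by rewrite linearZ rmorph1 !mxE nij mulr0.
Qed.
End Slice.

Section RowInvariance.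
Variables (K : fieldType) (q : K).
Variables (Delta : {rmorphism SLq3 q -> tensor (SLq3 q) (SLq3 q)}).
Hypothesis DeltaP : is_comultiplication Delta.

(** The slices of Delta u along [row_rep r s] form the matrix with rows (u, u')
    and (0, w u), by induction on the derivation of the triple (u, w, u'); u' is
    off the diagonal. *)
Lemma haar_row_step (haar : {scalar SLq3 q}) :
  is_haar_state Delta haar -> q != 0 -> forall (r s : 'I_3) u w u',
  (r, s) = (0, 1) \/ (r, s) = (1, 2) ->
  row_step q (xgen q) r s u w u' -> haar u' = 0.
Proof.
move=> haarP q0 r s u w u' rs step.
have [phi phiE] := SLq3_lift (row_rep_qmatrix q0 rs).
pose L i j := slice phi i j.
suff [_ <- _ _] : [/\ L 0 0 (Delta u) = u, L 0 1 (Delta u) = u',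
    L 1 0 (Delta u) = 0 & L 1 1 (Delta u) = w *: u].
  exact: haar_slice_offdiag.
elim: step => {u w u'}
  [i j||u a u' v b v' _ [u00 u01 u10 u11] _ [v00 v01 v10 v11]].
- have LE k l : L k l (Delta (xgen q i j)) =
      \sum_m row_rep q r s i m k l *: xgen q m j.
    rewrite DeltaP.2 /L (raddf_sum (slice phi k l)).
    by apply: eq_bigr => m _ /=; rewrite slice_tens phiE.
  have only (m0 : 'I_3) (F : 'I_3 -> K) : (forall m, m != m0 -> F m = 0) ->
      \sum_m F m *: xgen q m j = F m0 *: xgen q m0 j.
    move=> F0; rewrite (bigD1 m0) //= big1 ?addr0 // => m /F0 ->.
    by rewrite scale0r.
  rewrite !LE; split.
  - rewrite (only i) => [|m /negbTE mi]; rewrite !mxE /= ?eqxx ?scale1r //.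
    by rewrite eq_sym mi.
  - rewrite (only s) => [|m /negbTE ms]; rewrite !mxE /= ?ms ?andbF //.
    rewrite eqxx andbT.
    by case: eqP => _; rewrite ?scale1r ?scale0r.
  - by rewrite big1 // => m _; rewrite !mxE scale0r.
  - rewrite (only i) => [|m /negbTE mi]; rewrite !mxE /= ?eqxx ?mul1r //.
    by rewrite eq_sym mi mul0r.
- rewrite rmorph1 -tens1 /L !slice_tens rmorph1 !mxE.
  by rewrite !scale1r scale0r.
- have LM i j : L i j (Delta (u * v)) = L i 0 (Delta u) * L 0 j (Delta v) +
    L i 1 (Delta u) * L 1 j (Delta v).
    rewrite rmorphM /L sliceM !big_ord_recl big_ord0 addr0.
    by rewrite (_ : lift ord0 ord0 = 1) //; apply: val_inj.
  rewrite !LM u00 u01 u10 u11 v00 v01 v10 v11.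
  rewrite !(mul0r, mulr0, addr0, add0r) -!scalerAl -!scalerAr scalerA.
  by split.
Qed.
End RowInvariance.

(** * Calculus of the derivations on monomials *)

Section Moments.
Variables (K : fieldType) (q : K) (B : algType K) (x : 'I_3 -> 'I_3 -> B).
Hypotheses (q0 : q != 0) (xP : qmatrix q x).

(** The asymmetric q-number (q^(2n) - 1) / (q^2 - 1), as a sum so that it makes
    sense for every q. *)
Definition qnum n : K := \sum_(i < n) (q ^+ 2) ^+ i.

Lemma qnumS n : qnum n.+1 = 1 + q ^+ 2 * qnum n.
Proof.
rewrite /qnum big_ord_recl expr0 mulr_sumr; congr (_ + _).
by apply: eq_bigr => i _; rewrite -exprS.
Qed.

Lemma qnum0 : qnum 0 = 0.
Proof. exact: big_ord0. Qed.

Lemma qnumE n : (q ^+ 2 - 1) * qnum n = (q ^+ n) ^+ 2 - 1.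
Proof. by rewrite -subrX1 -exprM mulnC exprM. Qed.

Lemma qcommX (t : K) (y z : B) n :
  y * z = t *: (z * y) -> y ^+ n * z = t ^+ n *: (z * y ^+ n).
Proof.
move=> yz; elim: n => [|n IHn]; first by rewrite !expr0 mul1r mulr1 scale1r.
rewrite !exprS -mulrA IHn -scalerAr [y * (z * _)]mulrA yz -scalerAl scalerA.
by rewrite -mulrA mulrC.
Qed.

Lemma qcomm_sandwich (u v w : B) :
  u * v = q *: (v * u) -> v * w = q *: (w * v) -> GRing.comm (u * w) v.
Proof.
move=> uv vw; rewrite /GRing.comm.
have wv : w * v = q^-1 *: (v * w) by rewrite vw scalerA mulVf ?scale1r.
by rewrite -mulrA wv -scalerAr [u * (v * w)]mulrA uv -scalerAl scalerA mulVf //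
  scale1r mulrA.
Qed.

Section Step.
Variables r s : 'I_3.
Local Notation step := (row_step q x r s).

Lemma step_mul_killed u a u' v b :
  step u a u' -> step v b 0 -> step (u * v) (a * b) (b *: (u' * v)).
Proof. by move=> su sv; have := row_step_mul su sv; rewrite mulr0 add0r. Qed.

Lemma step_killed_mul u a v b v' :
  step u a 0 -> step v b v' -> step (u * v) (a * b) (u * v').
Proof.
by move=> su sv; have := row_step_mul su sv; rewrite mul0r scaler0 addr0.
Qed.

Lemma step_killedM u a v b :
  step u a 0 -> step v b 0 -> step (u * v) (a * b) 0.
Proof.
by move=> su sv; have := step_mul_killed su sv; rewrite mul0r scaler0.
Qed.

Lemma step_killedX u a n : step u a 0 -> step (u ^+ n) (a ^+ n) 0.
Proof.
move=> su; elim: n => [|n IHn]; first by rewrite !expr0; apply: row_step_one.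
by rewrite !exprS; apply: step_killedM.
Qed.

(** For n = 0 the exponent n.-1 is meaningless, but qnum 0 = 0. *)
Lemma stepX u u' n : step u q^-1 u' -> u * u' = q *: (u' * u) ->
  step (u ^+ n) (q ^- n) ((q / q ^+ n * qnum n) *: (u' * u ^+ n.-1)).
Proof.
move=> su uu'; elim: n => [|[_|n IHn]].
- by rewrite qnum0 mulr0 scale0r expr0 invr1; apply: row_step_one.
- by rewrite !expr1 mulfV // qnumS qnum0 mulr0 addr0 mulr1 scale1r mulr1.
rewrite exprS (_ : q ^- n.+2 = q^-1 * q ^- n.+1); last by rewrite exprS invfM.
have := row_step_mul su IHn; congr row_step.
rewrite -scalerAr [u * _]mulrA uu' -scalerAl scalerA -[u' * u * _]mulrA -exprS.
rewrite -scalerDl.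
by congr (_ *: _); rewrite [qnum n.+2]qnumS !exprS; field; rewrite q0 expf_neq0.
Qed.
End Step.

(** * Linear relations between moments *)

Variable tau : {scalar B}.
Hypothesis tau_inv : forall r s u w u', (r, s) = (0, 1) \/ (r, s) = (1, 2) ->
  row_step q x r s u w u' -> tau u' = 0.

Local Notation a := (x 0 0).
Local Notation b := (x 0 1).
Local Notation c := (x 0 2).
Local Notation d := (x 1 0).
Local Notation e := (x 1 1).
Local Notation f := (x 1 2).
Local Notation g := (x 2 0).
Local Notation h := (x 2 1).
Local Notation k := (x 2 2).
Local Notation M n := ((c * e * g) ^+ n).

Let tauZ t u : tau (t *: u) = t * tau u. Proof. exact: linearZ. Qed.
Let tauD u v : tau (u + v) = tau u + tau v. Proof. exact: raddfD. Qed.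

Let ce : GRing.comm c e. Proof. exact: (qm_anti xP). Qed.
Let cg : GRing.comm c g. Proof. exact: (qm_anti xP). Qed.
Let eg : GRing.comm e g. Proof. exact: (qm_anti xP). Qed.
Let fh : GRing.comm f h. Proof. exact: (qm_anti xP). Qed.
Let fg : GRing.comm f g. Proof. exact: (qm_anti xP). Qed.
Let cd : GRing.comm c d. Proof. exact: (qm_anti xP). Qed.
Let ch : GRing.comm c h. Proof. exact: (qm_anti xP). Qed.

Let dhc : GRing.comm (d * h) c.
Proof. by apply: commr_sym; apply: commrM. Qed.
(* d e = q e d and e h = q h e, and likewise for g: the two factors q cancel. *)
Let dhe : GRing.comm (d * h) e.
Proof. by apply: qcomm_sandwich; [apply: (qm_row xP)|apply: (qm_col xP)]. Qed.
Let dhg : GRing.comm (d * h) g.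
Proof. by apply: qcomm_sandwich; [apply: (qm_col xP)|apply: (qm_row xP)]. Qed.

(** Normal form of the words in the commuting elements c, e, g; every word met
    below is brought to one ending in such a monomial. *)
Definition mon i j l := c ^+ i * e ^+ j * g ^+ l.

Let monE i j l : c ^+ i * (e ^+ j * g ^+ l) = mon i j l.
Proof. by rewrite mulrA. Qed.

Let commXX (u v : B) n p : GRing.comm u v -> u ^+ n * v ^+ p = v ^+ p * u ^+ n.
Proof.
by move=> uv; apply: commrX; apply: commr_sym; apply: commrX; apply: commr_sym.
Qed.

Let monE' i j l : e ^+ j * (c ^+ i * g ^+ l) = mon i j l.
Proof. by rewrite mulrA (commXX _ _ (commr_sym ce)). Qed.

Let mon_c i j l : c * mon i j l = mon i.+1 j l.
Proof. by rewrite /mon !mulrA -exprS. Qed.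
Let mon_e i j l : e * mon i j l = mon i j.+1 l.
Proof. by rewrite -2!monE' mulrA -exprS. Qed.
Let mon_g i j l : g * mon i j l = mon i j l.+1.
Proof.
rewrite /mon exprS !mulrA; congr (_ * _); rewrite -mulrA.
by apply: commrM; apply: commrX; apply: commr_sym.
Qed.

Let ME n : M n = mon n n n.
Proof.
rewrite exprMn_comm; first by rewrite exprMn_comm.
by apply: commr_sym; apply: commrM; apply: commr_sym.
Qed.

Let cf : c * f = q *: (f * c). Proof. exact: (qm_col xP). Qed.
Let eh : e * h = q *: (h * e). Proof. exact: (qm_col xP). Qed.

Let s01 i j := row_step_gen q x 0 1 i j.
Let s12 i j := row_step_gen q x 1 2 i j.

Let c01 n : row_step q x 0 1 (c ^+ n) (q ^- n)
  ((q / q ^+ n * qnum n) *: (f * c ^+ n.-1)).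
Proof. exact: stepX (s01 0 2) cf. Qed.
Let e12 n : row_step q x 1 2 (e ^+ n) (q ^- n)
  ((q / q ^+ n * qnum n) *: (h * e ^+ n.-1)).
Proof. exact: stepX (s12 1 1) eh. Qed.
Let eg01 n p : row_step q x 0 1 (e ^+ n * g ^+ p) (q ^+ n * 1 ^+ p) 0.
Proof.
by apply: step_killedM; apply: step_killedX; [exact: s01 1 1|exact: s01 2 0].
Qed.
Let cg12 n p : row_step q x 1 2 (c ^+ n * g ^+ p) (1 ^+ n * q ^+ p) 0.
Proof.
by apply: step_killedM; apply: step_killedX; [exact: s12 0 2|exact: s12 2 0].
Qed.

Let dh_c y : c * (d * (h * y)) = d * (h * (c * y)).
Proof. by rewrite (mulrA d h y) [LHS]mulrA -dhc !mulrA. Qed.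
Let dh_e y : e * (d * (h * y)) = d * (h * (e * y)).
Proof. by rewrite (mulrA d h y) [LHS]mulrA -dhe !mulrA. Qed.
Let dh_g y : g * (d * (h * y)) = d * (h * (g * y)).
Proof. by rewrite (mulrA d h y) [LHS]mulrA -dhg !mulrA. Qed.
Let hf y : h * (f * y) = f * (h * y).
Proof. by rewrite !mulrA fh. Qed.
Let fd y : d * (f * y) = q *: (f * (d * y)).
Proof. by rewrite mulrA (qm_row xP) // -scalerAl mulrA. Qed.

Let g_f y : g * (f * y) = f * (g * y).
Proof. by rewrite !mulrA fg. Qed.
Let c_h n y : c ^+ n * (h * y) = h * (c ^+ n * y).
Proof. by rewrite !mulrA (commr_sym (commrX n (commr_sym ch))). Qed.
Let e_fX n : e ^+ n * f = q ^+ n *: (f * e ^+ n).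
Proof. by apply: qcommX; apply: (qm_row xP). Qed.
Let e_f n y : e ^+ n * (f * y) = q ^+ n *: (f * (e ^+ n * y)).
Proof. by rewrite mulrA e_fX -scalerAl mulrA. Qed.

Ltac solve_scalars := by field; rewrite ?expf_neq0 ?q0.

(* From the derivative of a monomial, the relation between the moments of the
   words in it; these words and those of the goal are put in right-associated
   form, ending in a [mon]. *)
Ltac invariance step :=
  rewrite ?ME; move: step;
  first [move/(tau_inv (or_introl erefl)) | move/(tau_inv (or_intror erefl))];
  rewrite /row_weight /= ?expr1n ?mul1r ?mulr1 !(=^~ scalerAl, =^~ scalerAr);
  rewrite ?scalerDr ?scalerA ?tauD ?tauZ;
  rewrite -?mulrA ?monE ?monE'.

Lemma moment_bfg n :
  qnum n.+1 * tau (b * f * g * M n) + q^-1 * tau (M n.+1) = 0.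
Proof.
invariance (row_step_mul (s01 0 1) (step_mul_killed (c01 n.+1) (eg01 n n.+1))).
rewrite mon_e mon_g => <-; rewrite exprS; solve_scalars.
Qed.

Lemma moment_cdh n :
  qnum n.+1 * tau (c * d * h * M n) + q^-1 * tau (M n.+1) = 0.
Proof.
invariance (row_step_mul (s12 1 0) (step_mul_killed (e12 n.+1) (cg12 n.+1 n))).
rewrite mon_g dh_c mon_c => <-; rewrite exprS; solve_scalars.
Qed.

Lemma moment_afh n :
  qnum n.+1 * tau (a * f * h * M n) + q^-1 * tau (c * d * h * M n) = 0.
Proof.
invariance (row_step_mul (s01 0 0)
  (step_killed_mul (s01 2 1) (step_mul_killed (c01 n.+1) (eg01 n n)))).
rewrite dh_c mon_c hf => <-; rewrite exprS; solve_scalars.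
Qed.

Lemma moment_bfgcdh n :
  qnum n.+2 * tau (b * f * g * c * d * h * M n)
  + q^-1 * tau (c * d * h * M n.+1) = 0.
Proof.
invariance (row_step_mul (s01 0 1)
  (step_killed_mul (s01 1 0) (step_killed_mul (s01 2 1)
    (step_mul_killed (c01 n.+2) (eg01 n n.+1))))).
rewrite hf fd dh_e !dh_c dh_g !mon_c mon_e mon_g -scalerAr tauZ.
move=> <-; rewrite !exprS; solve_scalars.
Qed.

Lemma moment_bdk n :
  q^-1 * tau (b * f * g * M n) + tau (b * d * k * M n) +
  q ^+ 2 * qnum n * tau (b * f * g * c * d * h * M n.-1) = 0.
Proof.
invariance (step_killed_mul (s12 0 1) (row_step_mul (s12 1 0)
  (row_step_mul (s12 1 2) (step_killed_mul (step_killedX n (s12 0 2))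
    (step_mul_killed (e12 n) (step_killedX n (s12 2 0))))))).
rewrite !(scalerDr, mulrDr) -!scalerAr ?scalerA !tauD !tauZ.
rewrite g_f c_h.
(* For n = 0 the derivative of e^n vanishes, and so does qnum n. *)
case: n => [|n].
  by rewrite qnum0 => H; rewrite -[RHS]H expr0 invr1; solve_scalars.
rewrite monE fd dh_c dh_g mon_c !mon_g -scalerAr tauZ /= => <-.
rewrite exprS; solve_scalars.
Qed.

Lemma moment_aemk n :
  tau (a * e ^+ n.+1 * k * c ^+ n * g ^+ n)
  + q^-1 * qnum n.+1 * tau (a * f * h * M n) = 0.
Proof.
invariance (step_killed_mul (s12 0 0) (row_step_mul (e12 n.+1)
  (step_mul_killed (s12 1 2) (cg12 n n)))).
rewrite !mulrDr -!scalerAr !tauD !tauZ e_f -!scalerAr tauZ monE' hf => H.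
apply: (mulfI (expf_neq0 n q0)); rewrite mulr0 -H [q ^+ n.+1]exprS.
solve_scalars.
Qed.

Let f_h_e n : e ^+ n * (f * h) = (q ^+ 2) ^+ n *: (f * h * e ^+ n).
Proof. by rewrite e_f (qcommX _ eh) -scalerAr scalerA mulrA -exprMn. Qed.

(** Since k e = e k - (q - q^-1) f h and e q^2-commutes with f h, moving k to the
    right across e^n costs a geometric sum of terms f h e^n. *)
Lemma ek_eX n : e * k * e ^+ n =
  e ^+ n.+1 * k - (q * ((q ^+ n) ^+ 2 - 1)) *: (f * h * e ^+ n).
Proof.
have ek : k * e = e * k - (q - q^-1) *: (f * h).
  by rewrite (qm_diag xP (i := 1) (j := 2) (k := 1) (l := 2)) // addrK.
elim: n => [|n IHn].
  by rewrite expr0 expr1 expr1n subrr mulr0 scale0r subr0 mulr1.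
have -> : e * k * e ^+ n.+1 = e * k * e ^+ n * e by rewrite exprSr mulrA.
rewrite IHn mulrBl -scalerAl -[e ^+ n.+1 * k * e]mulrA ek mulrBr -scalerAr f_h_e.
rewrite [e ^+ n.+1 * _]mulrA -[f * h * _ * e]mulrA -!exprSr -addrA -opprD.
rewrite scalerA -scalerDl; congr (_ - _ *: _).
by rewrite -exprM mulnC exprM [q ^+ n.+1]exprS; field.
Qed.

Lemma moment_aek n :
  tau (a * e * k * M n) + (q^-1 * qnum n.+1 + q * ((q ^+ n) ^+ 2 - 1))
    * tau (a * f * h * M n) = 0.
Proof.
have -> : a * e * k * M n =
    a * e ^+ n.+1 * k * c ^+ n * g ^+ n
    - (q * ((q ^+ n) ^+ 2 - 1)) *: (a * f * h * M n).
  rewrite ME /mon (commXX _ _ ce) !mulrA -[a * e * k]mulrA -[a * _ * _]mulrA.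
  rewrite ek_eX.
  by rewrite mulrBr !mulrBl !mulrA -!(scalerAr, scalerAl) !mulrA.
by rewrite raddfB /= tauZ -[RHS](moment_aemk n); ring.
Qed.

Lemma moment_det n :
  tau (a * e * k * M n) - q * tau (b * d * k * M n) - q * tau (a * f * h * M n)
  + q ^+ 2 * tau (b * f * g * M n) + q ^+ 2 * tau (c * d * h * M n)
  - q ^+ 3 * tau (M n.+1) = tau (M n).
Proof.
rewrite [M n.+1]exprS -[in RHS](mul1r (M n)) -(qm_det xP).
by rewrite !(mulrBl, mulrDl) -!scalerAl !(raddfB, raddfD) /= !tauZ.
Qed.

(** * Closed forms of the moments *)

Hypothesis q_nonroot : forall n, (0 < n)%N -> q ^+ n != 1.

Lemma subXq_neq0 n : (0 < n)%N -> q ^+ n - 1 != 0.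
Proof. by rewrite subr_eq0; apply: q_nonroot. Qed.

Lemma qnum_neq0 n : qnum n.+1 != 0.
Proof.
have: (q ^+ 2 - 1) * qnum n.+1 != 0.
  by rewrite qnumE -exprM subXq_neq0 ?muln_gt0.
by apply: contraNneq => ->; rewrite mulr0.
Qed.

Let solve_rel (u v t : K) :
  u != 0 -> u * v + q^-1 * t = 0 -> v = - (q * u)^-1 * t.
Proof.
move=> u0 H; apply: (mulfI u0); rewrite -[LHS](addrK (q^-1 * t)) H; field.
by rewrite u0 q0.
Qed.

Lemma tau_cdh n : tau (c * d * h * M n) = - (q * qnum n.+1)^-1 * tau (M n.+1).
Proof. exact: (solve_rel (qnum_neq0 n) (moment_cdh n)). Qed.

Lemma tau_bfg n : tau (b * f * g * M n) = - (q * qnum n.+1)^-1 * tau (M n.+1).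
Proof. exact: (solve_rel (qnum_neq0 n) (moment_bfg n)). Qed.

Lemma tau_afh n : tau (a * f * h * M n) = (q * qnum n.+1) ^- 2 * tau (M n.+1).
Proof.
rewrite (solve_rel (qnum_neq0 n) (moment_afh n)) tau_cdh.
by field; rewrite q0 qnum_neq0.
Qed.

Lemma tau_bfgcdh n :
  tau (b * f * g * c * d * h * M n) = (q * qnum n.+2) ^- 2 * tau (M n.+2).
Proof.
rewrite (solve_rel (qnum_neq0 n.+1) (moment_bfgcdh n)) tau_cdh.
by field; rewrite q0 qnum_neq0.
Qed.

(** In [moment_bdk] the contributions of bfg and bfgcdh combine through
    S (n+1) - q^2 S n = 1, with S = qnum, and bdk gets the same value as afh. *)
Lemma tau_bdk n : tau (b * d * k * M n) = (q * qnum n.+1) ^- 2 * tau (M n.+1).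
Proof.
apply: (addrI (q^-1 * tau (b * f * g * M n)
  + q ^+ 2 * qnum n * tau (b * f * g * c * d * h * M n.-1))).
rewrite addrAC moment_bdk tau_bfg.
have Sn0 := qnum_neq0 n; case: n Sn0 => [|n] Sn0.
  by rewrite !qnumS !qnum0 in Sn0 *; field; rewrite q0.
rewrite /= tau_bfgcdh; move: Sn0; rewrite [qnum n.+2]qnumS => Sn0.
by field; rewrite q0 Sn0.
Qed.

Lemma tau_aek n : tau (a * e * k * M n) =
  (q ^+ 2 - 1 - q ^+ 2 * qnum n.+1) / q * (q * qnum n.+1) ^- 2 * tau (M n.+1).
Proof.
apply: (addIr ((q^-1 * qnum n.+1 + q * ((q ^+ n) ^+ 2 - 1))
                * tau (a * f * h * M n))).
rewrite moment_aek -qnumE tau_afh; have := qnum_neq0 n; rewrite qnumS => Sn0.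
by field; rewrite q0 Sn0.
Qed.

(** Once all moments in [moment_det] are expressed by that of M (n+1), the
    coefficient of the latter factors as
    - q^-3 (1 + q^2 S) (1 + q^2 + q^4 S) / S^2 with S = qnum (n+1), and the two
    factors are the next two q-numbers. *)
Lemma tau_ceg_rec n :
  qnum n.+2 * qnum n.+3 * tau (M n.+1) = - q ^+ 3 * qnum n.+1 ^+ 2 * tau (M n).
Proof.
rewrite -(moment_det n) tau_aek tau_bdk tau_afh tau_bfg tau_cdh.
have := qnum_neq0 n; rewrite [qnum n.+3]qnumS [qnum n.+2]qnumS => Sn0.
by field; rewrite q0 Sn0.
Qed.

Hypothesis tau1 : tau 1 = 1.

Lemma tau_ceg n :
  tau (M n) = (- q) ^+ (3 * n) * qnum 2 / (qnum n.+1 ^+ 2 * qnum n.+2).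
Proof.
elim: n => [|n IHn].
  rewrite expr0 tau1 muln0 expr0 mul1r [qnum 1]qnumS qnum0 mulr0 addr0 expr1n.
  by rewrite mul1r mulfV ?qnum_neq0.
apply: (mulfI (mulf_neq0 (qnum_neq0 n.+1) (qnum_neq0 n.+2))).
rewrite tau_ceg_rec IHn mulnS exprD.
by field; rewrite !qnum_neq0.
Qed.

Let qnumF n : qnum n = (q ^+ (2 * n) - 1) / (q ^+ 2 - 1).
Proof.
apply: (mulfI (subXq_neq0 (isT : (0 < 2)%N))); rewrite qnumE mulnC exprM; field.
exact: subXq_neq0.
Qed.

Lemma moments_closed_form m :
  [/\ tau (a * e * k * M m) =
        (- q) ^+ (3 * m + 1) * (q ^+ 2 - 1) ^+ 3 * (q ^+ 4 - 1)
          * (1 + q ^+ 4 - q ^+ 2 - q ^+ (2 * m.+1 + 2))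
        / (q * (q ^+ (2 * m.+1) - 1) ^+ 2 * (q ^+ (2 * m.+1 + 2) - 1) ^+ 2
             * (q ^+ (2 * m.+1 + 4) - 1)),
      tau (a * f * h * M m) = tau (b * d * k * M m) /\
      tau (b * d * k * M m) =
        (- q) ^+ (3 * m + 1) * (q ^+ 2 - 1) ^+ 4 * (q ^+ 4 - 1)
        / ((q ^+ (2 * m.+1) - 1) ^+ 2 * (q ^+ (2 * m.+1 + 2) - 1) ^+ 2
             * (q ^+ (2 * m.+1 + 4) - 1)),
      tau (b * f * g * M m) = tau (c * d * h * M m) /\
      tau (c * d * h * M m) =
        (- q) ^+ (3 * m + 2) * (q ^+ 2 - 1) ^+ 3 * (q ^+ 4 - 1)
        / ((q ^+ (2 * m.+1) - 1) * (q ^+ (2 * m.+1 + 2) - 1) ^+ 2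
             * (q ^+ (2 * m.+1 + 4) - 1)),
      tau (M m) =
        (- q) ^+ (3 * m) * (q ^+ 2 - 1) ^+ 2 * (q ^+ 4 - 1)
        / ((q ^+ (2 * m + 2) - 1) ^+ 2 * (q ^+ (2 * m + 4) - 1)) &
      tau (b * f * g * c * d * h * M m) =
        (- q) ^+ (3 * m + 4) * (q ^+ 2 - 1) ^+ 4 * (q ^+ 4 - 1)
        / ((q ^+ (2 * m.+2) - 1) ^+ 2 * (q ^+ (2 * m.+2 + 2) - 1) ^+ 2
             * (q ^+ (2 * m.+2 + 4) - 1))].
Proof.
have [e2 e22 e24] : [/\ 2 * m.+1 = 2 * m + 2, 2 * m.+1 + 2 = 2 * m + 4
  & 2 * m.+1 + 4 = 2 * m + 6]%N by split; lia.
have [e4 e42 e44] : [/\ 2 * m.+2 = 2 * m + 4, 2 * m.+2 + 2 = 2 * m + 6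
  & 2 * m.+2 + 4 = 2 * m + 8]%N by split; lia.
have [e6 e8] : (2 * m.+3 = 2 * m + 6 /\ 2 * m.+4 = 2 * m + 8)%N by split; lia.
have [f3 f6] : (3 * m.+1 = 3 * m + 3 /\ 3 * m.+2 = 3 * m + 6)%N by split; lia.
have n2 := subXq_neq0 (isT : (0 < 2)%N).
have nz i : (0 < i)%N -> q ^+ (2 * m) * q ^+ i - 1 != 0.
  by move=> i0; rewrite -exprD subXq_neq0 // addn_gt0 i0 orbT.
have nz2 := nz 2 isT; have nz4 := nz 4 isT; have nz6 := nz 6 isT.
have nz8 := nz 8 isT.
rewrite tau_aek tau_afh tau_bdk tau_bfg tau_cdh tau_bfgcdh !tau_ceg !qnumF.
rewrite (_ : 2 * 2 = 4)%N // e22 e24 e42 e44 e2 e4 e6 e8 f3 f6.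
(* With q^(2m) and (-q)^(3m) as atoms, these are identities of rational functions. *)
have qD i : q ^+ (2 * m + i) = q ^+ (2 * m) * q ^+ i by rewrite exprD.
have uD i : (- q) ^+ (3 * m + i) = (- q) ^+ (3 * m) * (- q) ^+ i.
  by rewrite exprD.
rewrite !qD !uD {qD uD}.
move: (q ^+ (2 * m)) ((- q) ^+ (3 * m)) nz2 nz4 nz6 nz8 => Q u nz2 nz4 nz6 nz8.
split; [|split|split| |] => //; by field; rewrite ?q0 ?n2 ?nz2 ?nz4 ?nz6 ?nz8.
Qed.

End Moments.

Theorem mainTheorem2 (R : realType) (q : R[i]) (hq : 0 < `|q| < 1)
    (Delta : {rmorphism SLq3 q -> tensor (SLq3 q) (SLq3 q)})
    (hDelta : is_comultiplication Delta)
    (haar : {scalar SLq3 q}) (hhaar : is_haar_state Delta haar) :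
  let a := xgen q 0 0 in let b := xgen q 0 1 in let c := xgen q 0 2 in
  let d := xgen q 1 0 in let e := xgen q 1 1 in let f := xgen q 1 2 in
  let g := xgen q 2 0 in let h := xgen q 2 1 in let k := xgen q 2 2 in
  (forall m : nat, (1 <= m)%N ->
    [/\ haar (a * e * k * (c * e * g) ^+ (m - 1)) =
          (- q) ^+ (3 * m - 2) * (q ^+ 2 - 1) ^+ 3 * (q ^+ 4 - 1)
            * (1 + q ^+ 4 - q ^+ 2 - q ^+ (2 * m + 2))
          / (q * (q ^+ (2 * m) - 1) ^+ 2 * (q ^+ (2 * m + 2) - 1) ^+ 2
               * (q ^+ (2 * m + 4) - 1)),
        haar (a * f * h * (c * e * g) ^+ (m - 1)) =
          haar (b * d * k * (c * e * g) ^+ (m - 1)) /\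
        haar (b * d * k * (c * e * g) ^+ (m - 1)) =
          (- q) ^+ (3 * m - 2) * (q ^+ 2 - 1) ^+ 4 * (q ^+ 4 - 1)
          / ((q ^+ (2 * m) - 1) ^+ 2 * (q ^+ (2 * m + 2) - 1) ^+ 2
               * (q ^+ (2 * m + 4) - 1)),
        haar (b * f * g * (c * e * g) ^+ (m - 1)) =
          haar (c * d * h * (c * e * g) ^+ (m - 1)) /\
        haar (c * d * h * (c * e * g) ^+ (m - 1)) =
          (- q) ^+ (3 * m - 1) * (q ^+ 2 - 1) ^+ 3 * (q ^+ 4 - 1)
          / ((q ^+ (2 * m) - 1) * (q ^+ (2 * m + 2) - 1) ^+ 2
               * (q ^+ (2 * m + 4) - 1)) &
        haar ((c * e * g) ^+ m) =
          (- q) ^+ (3 * m) * (q ^+ 2 - 1) ^+ 2 * (q ^+ 4 - 1)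
          / ((q ^+ (2 * m + 2) - 1) ^+ 2 * (q ^+ (2 * m + 4) - 1))]) /\
  (forall m : nat, (2 <= m)%N ->
    haar (b * f * g * c * d * h * (c * e * g) ^+ (m - 2)) =
      (- q) ^+ (3 * m - 2) * (q ^+ 2 - 1) ^+ 4 * (q ^+ 4 - 1)
      / ((q ^+ (2 * m) - 1) ^+ 2 * (q ^+ (2 * m + 2) - 1) ^+ 2
           * (q ^+ (2 * m + 4) - 1))).
Proof.
move: hq; rewrite normr_gt0 => /andP[q0 q1] a b c d e f g h k.
have q_nonroot n : (0 < n)%N -> q ^+ n != 1.
  move=> n0; apply/negP => /eqP qn; have := exprn_ilt1 n (normr_ge0 q) q1.
  by rewrite -normrX qn normr1 Order.POrderTheory.ltxx -lt0n n0.
have inv r s u w u' : (r, s) = (0, 1) \/ (r, s) = (1, 2) ->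
    row_step q (xgen q) r s u w u' -> haar u' = 0.
  exact: (haar_row_step hDelta hhaar q0).
have [xP haar1] := (xgen_qmatrix q, hhaar.1).
have moments := moments_closed_form q0 xP inv q_nonroot haar1.
split=> [[|m]|[|[|m]]] // _.
  have [Haek Hafh Hbfg _ _] := moments m.
  have [_ _ _ Hceg _] := moments m.+1.
  rewrite subSS subn0 (_ : 3 * m.+1 - 2 = 3 * m + 1)%N; last by lia.
  by rewrite (_ : 3 * m.+1 - 1 = 3 * m + 2)%N; last by lia.
have [_ _ _ _ HD] := moments m.
rewrite (_ : m.+2 - 2 = m)%N; last by lia.
by rewrite (_ : 3 * m.+2 - 2 = 3 * m + 4)%N; last by lia.
Qed.
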